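(* (i) As $n\to\infty$, $$\inf_{x\ge 0}\ \sup_{\mathcal{P}_n}\left|\frac{\mathbf{P}(t_n^*\ge x)}{\Psi_n^c(x)}-1\right|\ \ge\ \frac14+o(1),$$ that is, the limit inferior of the left-hand side as $n\to\infty$ is at least $1/4$. (ii) If $\{x_n\}_{n\ge1}$ is a non-decreasing sequence of positive numbers such that $x_n\to\infty$ and $x_n/\sqrt{n}\to0$ as $n\to\infty$, then $$\sup_{\mathcal{P}_n}\left|\frac{\mathbf{P}(t_n^*\ge x_n)}{\Psi_n^c(x_n)}-1\right|\to\infty\qquad(n\to\infty).$$
   Context: $\Psi_n$ is the distribution function of Student's distribution with $n$ degrees of freedom, i.e. the distribution with density $$\psi_n(x)=C_n\left(1+\frac{x^2}{n}\right)^{-(n+1)/2}\quad(x\in\mathbb{R}),\qquad C_n=\frac{\Gamma((n+1)/2)}{\sqrt{\pi n}\,\Gamma(n/2)},$$ and $\Psi_n^c=1-\Psi_n$. For $n\ge1$, $\mathcal{P}_n$ is the class of distributions of random vectors $(X_1,\dots,X_n)$ where $X_1,\dots,X_n$ are independent and identically distributed bounded real random variables with $\mathbf{E}X_1=0$ and $\mathbf{E}X_1^2=1$ (the bound on $|X_1|$ may depend on the distribution and is not uniform over the class). The supremum $\sup_{\mathcal{P}_n}$ is over all such distributions. The self-normalised sum is $$t_n^*=\frac{S_n}{T_n^{1/2}},\qquad S_n=\sum_{i=1}^nX_i,\qquad T_n=\sum_{i=1}^nX_i^2,$$ with the convention $t_n^*=0$ when $T_n=0$. *)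

(* Defs.v *)
From HB Require Import structures.
From mathcomp Require Import all_boot all_order all_algebra.
From mathcomp Require Import all_classical all_reals all_analysis.

Set Implicit Arguments.
Unset Strict Implicit.
Unset Printing Implicit Defensive.

Import Order.TTheory GRing.Theory Num.Theory.
Import numFieldNormedType.Exports.

Local Open Scope classical_set_scope.
Local Open Scope ring_scope.

Definition Gamma (R : realType) (s : R) : R :=
  \int[lebesgue_measure]_(t in `]0, +oo[) (t `^ (s - 1) * expR (- t)).

Definition student_cst (R : realType) (n : nat) : R :=
  Gamma (n.+1%:R / 2) / (Num.sqrt (pi * n%:R) * Gamma (n%:R / 2)).

Definition student_pdf (R : realType) (n : nat) (x : R) : R :=
  student_cst R n * (1 + x ^+ 2 / n%:R) `^ (- (n.+1%:R / 2)).

Definition student_cdf (R : realType) (n : nat) (x : R) : R :=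
  \int[lebesgue_measure]_(t in `]-oo, x]) student_pdf n t.

Definition student_ccdf (R : realType) (n : nat) (x : R) : R :=
  1 - student_cdf n x.

Definition independent_RVs d (T : measurableType d) (R : realType)
    (P : probability T R) (I : finType) (X : I -> {RV P >-> R}) : Prop :=
  forall (J : {set I}) (A : I -> set R), (forall i, measurable (A i)) ->
    P (\bigcap_(i in [set` J]) (X i @^-1` A i)) =
    (\prod_(i in J) P (X i @^-1` A i))%E.

Definition identically_distributed d (T : measurableType d) (R : realType)
    (P : probability T R) (I : Type) (X : I -> {RV P >-> R}) : Prop :=
  forall (i j : I) (A : set R), measurable A ->
    distribution P (X i) A = distribution P (X j) A.

(* The values of a measure outside the sigma-algebra carry no meaning, so the
   law of the random vector is compared with mu on measurable sets only. *)
Definition law_class (R : realType) (n : nat) :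
    set (probability (n.-tuple R) R) :=
  [set mu : probability (n.-tuple R) R |
    exists (d : measure_display) (T : measurableType d)
      (P : probability T R) (X : 'I_n -> {RV P >-> R}),
    [/\ independent_RVs X,
        identically_distributed X,
        (exists M : R, forall i w, `|X i w| <= M),
        (forall i, 'E_P[X i] = 0 /\ 'E_P[fun w => (X i w ^+ 2)%R] = 1)%E &
        forall A : set (n.-tuple R), measurable A ->
          mu A = P ((fun w => [tuple X i w | i < n]) @^-1` A)]].

Definition self_normalised_sum (R : realType) (n : nat) (v : n.-tuple R) : R :=
  let S := \sum_(i < n) tnth v i in
  let T := \sum_(i < n) tnth v i ^+ 2 in
  if T == 0 then 0 else S / Num.sqrt T.

(* The deviations are real, but their supremum is taken in \bar R, where it
   always exists (and may be +oo). *)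
Definition sup_rel_error (R : realType) (n : nat) (x : R) : \bar R :=
  ereal_sup [set `| fine (mu [set v | x <= self_normalised_sum v])
                      / student_ccdf n x - 1 |%:E | mu in @law_class R n].

(* Main.v *)
Require Import Defs.
From HB Require Import structures.
From mathcomp Require Import all_boot all_order all_algebra ring lra zify.
From mathcomp Require Import all_classical all_reals all_analysis.
From mathcomp Require Import measurable_realfun.

Set Implicit Arguments.
Unset Strict Implicit.
Unset Printing Implicit Defensive.

Import Order.TTheory GRing.Theory Num.Theory.
Import numFieldNormedType.Exports.

Local Open Scope classical_set_scope.
Local Open Scope ring_scope.

(** The self-normalised sum of a constant vector [c, ..., c] is [sg c * sqrt n],
    its extreme value in the direction of the sign of [c]. A law in the class
    can be as close as one wishes to such a constant: let each coordinate take
    one value of sign [s] with probability [q] and another value of the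
    opposite sign with probability [1 - q]; centring and unit variance fix both
    values for every [q] in (0, 1), and all coordinates take the common value
    with probability [q ^+ n], which tends to 1 as [q] does
    ([near_constant_law]). As no bound on the moments beyond the second is
    uniform over the class, nothing forbids this.

    For [s = -1] the sum is then [- sqrt n] with probability close to 1, so the
    event [x <= t] has arbitrarily small probability for every [x >= 0], and
    the relative error is arbitrarily close to 1. Hence it is at least 1/2
    whatever the value of the Student tail at [x] ([sup_rel_error_ge_half]);
    this gives (i).

    For [s = 1] the sum is [sqrt n] with probability at least 1/2, so for
    [x n <= sqrt n] the relative error is at least [1 / (2 * ccdf) - 1]
    ([sup_rel_error_ge]). This tends to infinity because the Student tail
    [ccdf] is positive ([student_ccdf_gt0]) and tends to 0 along any sequence
    tending to infinity ([student_ccdf_cvg0]); this gives (ii).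

    Positivity of the tail needs the exact normalisation of the density. It
    comes from integrating
    [t `^ (s - 1/2) * expR (- ((1 + x ^+ 2 / nu) * t))] over [t > 0] and over
    all [x] in both orders: the integral over [t] first produces the Student
    kernel times a Gamma value, the integral over [x] first is Gaussian
    ([gamma_student_integral]). The same identity, started from Gamma(1) = 1,
    shows that all the Gamma values involved are positive and finite. The
    convergence of the tail to 0, uniformly in [n], comes from the domination
    of all Student kernels by [2 / (1 + t ^+ 2)] ([student_kernel_le]). *)

(** * Independent two-valued trials *)

Section repeated_trials.
Variable R : realType.
Implicit Types (q : R) (n : nat).

Definition trial_weight q (b : bool) : R := if b then q else 1 - q.

Definition trial_mass q (B : set bool) : R :=
  \sum_(b : bool) trial_weight q b * \1_B b.

Definition trials_weight q n (f : {ffun 'I_n -> bool}) : R :=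
  \prod_(i < n) trial_weight q (f i).

Lemma trial_weight_ge0 q b : 0 <= q <= 1 -> 0 <= trial_weight q b.
Proof. by case/andP=> q0 q1; case: b => //=; rewrite subr_ge0. Qed.

Lemma trial_massT q : trial_mass q setT = 1.
Proof.
by rewrite /trial_mass big_bool/= !indicT !mulr1 addrC subrK.
Qed.

(** Expanding the product of the one-trial sums enumerates the outcomes; this
    is independence of the trials in the form used below. *)
Lemma sum_trials_cylinder q n (B : 'I_n -> set bool) :
  \sum_(f : {ffun 'I_n -> bool})
     trials_weight q f * \prod_(i < n) \1_(B i) (f i) =
  \prod_(i < n) trial_mass q (B i).
Proof.
rewrite /trial_mass bigA_distr_bigA/=; apply: eq_bigr => f _.
by rewrite -big_split.
Qed.

Lemma sum_trials_weight q n :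
  \sum_(f : {ffun 'I_n -> bool}) trials_weight q f = 1.
Proof.
transitivity (\prod_(i < n) trial_mass q setT); last first.
  by rewrite big1// => i _; rewrite trial_massT.
rewrite -sum_trials_cylinder; apply: eq_bigr => f _.
by rewrite big1 ?mulr1// => i _; rewrite indicT.
Qed.

Lemma trials_weight_ge0 q n (f : {ffun 'I_n -> bool}) :
  0 <= q <= 1 -> 0 <= trials_weight q f.
Proof. by move=> q01; apply: prodr_ge0 => i _; exact: trial_weight_ge0. Qed.

(** A finite sum of weighted Dirac masses. The formula holds for every set [A],
    measurable or not, which spares proving that the events considered later
    are measurable. *)
Lemma trials_probability q n : 0 <= q <= 1 ->
  exists P : probability (n.-tuple bool) R, forall A,
    P A = (\sum_(f : {ffun 'I_n -> bool})
             trials_weight q f * \1_A [tuple f i | i < n])%:E.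
Proof.
move=> q01.
pose f0 : {ffun 'I_n -> bool} := [ffun=> true].
pose f_ k : {ffun 'I_n -> bool} := nth f0 (enum {ffun 'I_n -> bool}) k.
pose m k : {measure set (n.-tuple bool) -> \bar R} :=
  mscale (NngNum (trials_weight_ge0 (f_ k) q01)) (\d_[tuple f_ k i | i < n]).
pose M := msum m #|{ffun 'I_n -> bool}|.
have ME A : M A = (\sum_(f : {ffun 'I_n -> bool})
             trials_weight q f * \1_A [tuple f i | i < n])%:E.
  rewrite /M /msum -sumEFin cardT -(big_mkord xpredT (fun k => m k A)).
  rewrite -[RHS]big_enum/= (big_nth f0)/=; apply: eq_bigr => k _.
  by rewrite /m/= /mscale/=.
have MT : M setT = 1%E.
  rewrite ME; congr EFin; rewrite -[RHS](sum_trials_weight q n).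
  by apply: eq_bigr => f _; rewrite indicT mulr1.
pose P : probability (n.-tuple bool) R :=
  HB.pack M (Measure_isProbability.Build _ _ _ M MT).
by exists P.
Qed.

End repeated_trials.

Section iid_two_valued.
Variable R : realType.
Implicit Types (q : R) (n : nat).

Lemma indic_bigcap_tuple n (J : {set 'I_n}) (B : 'I_n -> set bool)
    (f : {ffun 'I_n -> bool}) :
  \1_(\bigcap_(i in [set` J]) ((fun w => tnth w i) @^-1` B i))
    [tuple f i | i < n] =
  \prod_(i < n) \1_(if i \in J then B i else setT) (f i) :> R.
Proof.
rewrite indicE; have [/set_mem inB|notB] := boolP (_ \in _).
  rewrite big1// => i _; case: ifPn => iJ; last by rewrite indicT.
  rewrite indicE mem_set//; have /= := inB i iJ.
  by rewrite tnth_mktuple.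
apply/esym/eqP; rewrite prodf_seq_eq0; apply: contraNT notB => /hasPn h.
apply/mem_set => i /= iJ; rewrite tnth_mktuple.
have := h i (mem_index_enum i); rewrite /= iJ indicE.
by case: (boolP (_ \in _)) => [/set_mem//|]; rewrite /= eqxx.
Qed.

Section fixed_probability.
Variables (q : R) (n : nat) (P : probability (n.-tuple bool) R).
Hypothesis PE : forall A, P A = (\sum_(f : {ffun 'I_n -> bool})
  trials_weight q f * \1_A [tuple f i | i < n])%:E.

Lemma trials_cylinder (J : {set 'I_n}) (B : 'I_n -> set bool) :
  P (\bigcap_(i in [set` J]) ((fun w => tnth w i) @^-1` B i)) =
  (\prod_(i in J) trial_mass q (B i))%:E.
Proof.
rewrite PE; congr EFin.
transitivity (\prod_(i < n) trial_mass q (if i \in J then B i else setT)).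
  rewrite -sum_trials_cylinder; apply: eq_bigr => f _.
  by rewrite -indic_bigcap_tuple.
rewrite [RHS]big_mkcond/=; apply: eq_bigr => i _.
by case: ifPn => // _; rewrite trial_massT.
Qed.

Lemma trials_marginal (i : 'I_n) (B : set bool) :
  P ((fun w => tnth w i) @^-1` B) = (trial_mass q B)%:E.
Proof.
have := trials_cylinder [set i] (fun=> B).
rewrite big_set1 => <-; congr (P _).
apply/seteqP; split => [w Bw j /=|w /(_ i)/=]; first by rewrite inE => /eqP ->.
by apply; rewrite inE.
Qed.

(** The outcome [true, ..., true] alone has mass [q ^+ n]. *)
Lemma trials_value_ge (A : set (n.-tuple bool)) :
  0 <= q <= 1 -> A [tuple true | i < n] -> q ^+ n <= fine (P A).
Proof.
move=> q01 At; rewrite PE/= (bigD1 [ffun=> true])//=.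
rewrite indicE mem_set ?mulr1; last first.
  rewrite (_ : [tuple _ | i < n] = [tuple true | i < n])//.
  by apply: eq_from_tnth => i; rewrite !tnth_mktuple ffunE.
have -> : trials_weight q ([ffun=> true] : {ffun 'I_n -> bool}) = q ^+ n.
  rewrite /trials_weight (eq_bigr (fun=> q)) => [|i _]; last by rewrite ffunE.
  by rewrite prodr_const card_ord.
rewrite lerDl; apply: sumr_ge0 => f _.
by rewrite mulr_ge0// trials_weight_ge0.
Qed.

Lemma trials_value_le (A : set (n.-tuple bool)) :
  0 <= q <= 1 -> ~ A [tuple true | i < n] -> fine (P A) <= 1 - q ^+ n.
Proof.
move=> q01 NAt; have := trials_value_ge q01 (NAt : (~` A) _).
rewrite !PE/= lerBrDl -lerBrDr; congr (_ <= _).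
rewrite -[in RHS](sum_trials_weight q n) -sumrB; apply: eq_bigr => f _.
rewrite indicC indicE; case: (_ \in _) => /=; rewrite ?mulr1 ?mulr0;
  by rewrite ?subrr ?subr0.
Qed.

Lemma measurable_trial (i : 'I_n) (g : bool -> R) :
  measurable_fun [set: n.-tuple bool] (fun w => g (tnth w i)).
Proof.
apply: (@measurableT_comp _ _ _ _ _ _ g); last exact: measurable_tnth.
by move=> _ Y mY; rewrite setTI.
Qed.

(** Any function of one trial is an affine function of the indicator of the
    outcome [true]. *)
Lemma trials_expectation (i : 'I_n) (g : bool -> R) :
  ('E_P[fun w => g (tnth w i)] = (q * g true + (1 - q) * g false)%:E)%E.
Proof.
set A := (fun w : n.-tuple bool => tnth w i) @^-1` [set true].
have mA : measurable A.
  by rewrite -[A]setTI; apply: measurable_tnth.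
have -> : (fun w : n.-tuple bool => g (tnth w i)) =
          ((g true - g false) \o* \1_A) \+ cst (g false).
  apply/funext => w /=; rewrite indicE.
  case E : (tnth w i).
    by rewrite mem_set/= ?mul1r ?subrK.
  by rewrite memNset/= ?mul0r ?add0r// /A/= E.
have L1 : \1_A \in Lfun P 1.
  by apply/Lfun1_integrable; exact: integrable_indic.
rewrite expectationD ?expectationZl ?expectation_cst ?expectation_indic//.
- rewrite trials_marginal -EFinM -EFinD; congr EFin.
  rewrite /trial_mass big_bool/= !indicE mem_set//= memNset//=; ring.
- exact: Lfun_scale.
- exact: Lfun_cst.
Qed.

End fixed_probability.

(** The law of a vector of independent copies of a centred, normalised
    two-valued variable lies in the class. The bounds on [mu A] are all that is
    kept of it: it charges the constant vector [g true] with mass at least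
    [q ^+ n]. *)
Lemma two_valued_law q n (g : bool -> R) : 0 <= q <= 1 ->
  q * g true + (1 - q) * g false = 0 ->
  q * g true ^+ 2 + (1 - q) * g false ^+ 2 = 1 ->
  exists2 mu : probability (n.-tuple R) R, law_class mu &
    forall A, (A [tuple g true | i < n] -> q ^+ n <= fine (mu A)) /\
              (~ A [tuple g true | i < n] -> fine (mu A) <= 1 - q ^+ n).
Proof.
move=> q01 mean0 var1.
have [P PE] := trials_probability n q01.
pose X_ (i : 'I_n) := fun w : n.-tuple bool => g (tnth w i).
pose X (i : 'I_n) : {RV P >-> R} :=
  HB.pack (X_ i) (isMeasurableFun.Build _ _ _ _ (X_ i) (measurable_trial i g)).
pose V (w : n.-tuple bool) := [tuple X i w | i < n].
have mV : measurable_fun setT V.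
  apply/measurable_fun_tnthP => i.
  apply: eq_measurable_fun (measurable_trial i g) => w _ /=.
  by rewrite tnth_mktuple.
pose W : {mfun n.-tuple bool >-> n.-tuple R} :=
  HB.pack V (isMeasurableFun.Build _ _ _ _ V mV).
exists (distribution P W).
  exists _, _, P, X; split => //.
  - move=> J A mA.
    rewrite (trials_cylinder PE J (fun i => g @^-1` A i)) -prodEFin.
    apply: eq_bigr => i _.
    by rewrite -(trials_marginal PE i).
  - move=> i j A mA; rewrite /distribution /pushforward.
    rewrite -[LHS]/(P ((fun w => tnth w i) @^-1` (g @^-1` A))).
    rewrite -[RHS]/(P ((fun w => tnth w j) @^-1` (g @^-1` A))).
    by rewrite !(trials_marginal PE).
  - exists (`|g true| + `|g false|) => i w /=; rewrite /X_.
    by case: (tnth w i); rewrite ?lerDl ?lerDr.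
  - move=> i; split.
      by apply: etrans (trials_expectation PE i g) _; rewrite mean0.
    apply: etrans (trials_expectation PE i (fun b => g b ^+ 2)) _.
    by rewrite var1.
move=> A; rewrite /distribution /pushforward.
have -> : [tuple g true | i < n] = W [tuple true | i < n].
  by apply: eq_from_tnth => i; rewrite !tnth_mktuple/= /X_ tnth_mktuple.
by split; [exact: (trials_value_ge PE)|exact: (trials_value_le PE)].
Qed.

End iid_two_valued.

(** * Laws concentrated near a constant vector *)

Section self_normalised_sums_of_near_constants.
Variable R : realType.

Lemma self_normalised_sum_cst n (c : R) : (0 < n)%N -> c != 0 ->
  self_normalised_sum [tuple c | i < n] = Num.sg c * Num.sqrt n%:R.
Proof.
move=> n0 c0; rewrite /self_normalised_sum.
have -> : \sum_(i < n) tnth [tuple c | i < n] i = \sum_(i < n) c.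
  by apply: eq_bigr => i _; rewrite tnth_mktuple.
have -> : \sum_(i < n) tnth [tuple c | i < n] i ^+ 2 = \sum_(i < n) c ^+ 2.
  by apply: eq_bigr => i _; rewrite tnth_mktuple.
rewrite !sumr_const card_ord -[c ^+ 2 *+ n]mulr_natr.
have nR0 : 0 < n%:R :> R by rewrite ltr0n.
rewrite mulf_eq0 sqrf_eq0 (negbTE c0) (gt_eqF nR0)/=.
rewrite sqrtrM ?sqr_ge0// sqrtr_sqr -[c *+ n]mulr_natr.
have r0 : Num.sqrt n%:R != 0 :> R by rewrite gt_eqF// sqrtr_gt0.
rewrite -[X in c * X](sqr_sqrtr (ltW nR0)) {1}[c]numEsg; field.
by rewrite r0 normr_eq0 c0.
Qed.

(** Here [s] is the sign of the predominant value and [theta] its probability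
    of being taken by all coordinates at once. *)
Lemma near_constant_law n (s theta : R) : (0 < n)%N -> 0 < theta < 1 ->
  s ^+ 2 = 1 ->
  exists2 mu : probability (n.-tuple R) R, law_class mu &
    exists2 c : R, 0 < c &
    forall A, (A [tuple s * c | i < n] -> theta <= fine (mu A)) /\
              (~ A [tuple s * c | i < n] -> fine (mu A) <= 1 - theta).
Proof.
move=> n0 /andP[t0 t1] s2.
pose q := theta `^ n%:R^-1.
have nR0 : 0 < n%:R :> R by rewrite ltr0n.
have q0 : 0 < q by rewrite powR_gt0.
have qn : q ^+ n = theta.
  by rewrite -powR_mulrn ?(ltW q0)// -powRrM mulVf ?gt_eqF// powRr1// ltW.
have q1 : q < 1.
  rewrite ltNge; apply: contraTN t1 => q1; rewrite -leNgt -qn.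
  exact: exprn_ege1.
have p0 : 0 < 1 - q by rewrite subr_gt0.
(* Centring forces the values [s * c] and [- s * (q / (1 - q)) * c]; unit
   variance then gives [c ^+ 2 = (1 - q) / q], and the second value is
   [- s / c]. *)
pose c := Num.sqrt ((1 - q) / q).
have c0 : 0 < c by rewrite sqrtr_gt0 divr_gt0.
have c2 : c ^+ 2 = (1 - q) / q by rewrite sqr_sqrtr// ltW// divr_gt0.
pose g b := if b then s * c else - s / c.
have q01 : 0 <= q <= 1 by rewrite !ltW.
have [||mu mul muA] := @two_valued_law R q n g q01.
- rewrite /g (_ : q * (s * c) = q * c ^+ 2 * s / c); last first.
    by field; rewrite gt_eqF.
  by rewrite c2; field; rewrite !gt_eqF.
- rewrite /g exprMn expr_div_n sqrrN s2 c2; field.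
  by rewrite !gt_eqF.
by exists mu => //; exists c => // A; rewrite -qn; exact: muA.
Qed.

(** A predominant positive value puts the sum at its maximum [sqrt n] with
    probability at least [theta], hence above any [x <= sqrt n]. *)
Lemma sup_rel_error_ge n (x theta : R) : (0 < n)%N -> 0 < theta < 1 ->
  x <= Num.sqrt n%:R -> student_ccdf n x != 0 ->
  ((theta / `|student_ccdf n x| - 1)%:E <= sup_rel_error n x)%E.
Proof.
move=> n0 t01 xn D0.
have [|mu mul [c c0 muA]] := @near_constant_law n 1 theta n0 t01.
  by rewrite expr1n.
apply: ereal_sup_ge; eexists; first by exists mu.
set A := [set v | _].
have [/(_ _)/[swap] _ tA] := muA A.
have At : A [tuple 1 * c | i < n].
  rewrite /A/= mul1r self_normalised_sum_cst ?gt_eqF// gtr0_sg// mul1r//.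
rewrite lee_fin.
have h := tA At.
apply: le_trans (lerB_dist _ _); rewrite normr1 normrM normfV lerB// ler_wpM2r//.
by rewrite (le_trans h)// ler_norm.
Qed.

(** A predominant negative value makes the event [x <= t] nearly impossible: its
    probability can be made small compared with any nonzero value of the tail.
    At a tail equal to 0 the quotient is 0 by convention and the error is 1. *)
Lemma sup_rel_error_ge_half n (x : R) : (0 < n)%N -> 0 <= x ->
  ((1 / 2)%:E <= sup_rel_error n x)%E.
Proof.
move=> n0 x0; set D := student_ccdf n x.
(* The probability [eta] of the event has to be at most half the tail. *)
pose eta : R := if D == 0 then 1 / 2 else Num.min (1 / 2) (`|D| / 2).
have eta0 : 0 < eta.
  rewrite /eta; case: eqVneq => D0; first by rewrite divr_gt0.
  by rewrite lt_min !divr_gt0// normr_gt0.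
have eta2 : eta <= 1 / 2.
  by rewrite /eta; case: eqVneq => // D0; rewrite ge_min lexx.
have t01 : 0 < 1 - eta < 1 by apply/andP; split; lra.
have [|mu mul [c c0 muA]] := @near_constant_law n (-1) (1 - eta) n0 t01.
  by rewrite sqrrN expr1n.
apply: ereal_sup_ge; eexists; first by exists mu.
set A := [set v | _].
have [_ tA] := muA A.
have At : ~ A [tuple -1 * c | i < n].
  rewrite /A/= mulN1r self_normalised_sum_cst ?oppr_eq0 ?gt_eqF//.
  rewrite ltr0_sg ?oppr_lt0// mulN1r; apply/negP; rewrite -ltNge.
  by rewrite (lt_le_trans _ x0)// oppr_lt0 sqrtr_gt0 ltr0n.
have := tA At; rewrite opprB addrC subrK => mA.
have m0 : 0 <= fine (mu A) by rewrite fine_ge0.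
rewrite lee_fin distrC -/D.
have [D0|D0] := eqVneq D 0.
  by rewrite D0 invr0 mulr0 subr0 normr1; lra.
have nD0 : 0 < `|D| by rewrite normr_gt0.
apply: le_trans (lerB_dist _ _); rewrite normr1 normrM normfV ger0_norm//.
suff : fine (mu A) / `|D| <= 1 / 2 by lra.
rewrite ler_pdivrMr// (le_trans mA)// /eta (negbTE D0) ge_min.
by apply/orP; right; rewrite mulrC mul1r.
Qed.

End self_normalised_sums_of_near_constants.

(** * The Gamma integral and the normalisation of the Student density *)

Section student_normalisation.
Variable R : realType.
Local Notation mu := (@lebesgue_measure R).
Implicit Types s c t x nu : R.

(** Lebesgue measure is [c] times its image under the dilation by [c], since
    both agree on half-open intervals. *)
Lemma ge0_integral_dilation c (f : R -> \bar R) : 0 < c ->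
  measurable_fun [set: R] f -> (forall x, 0 <= f x)%E ->
  (\int[mu]_x f x = c%:E * \int[mu]_x f (c * x)%R)%E.
Proof.
move=> c0 mf f0.
have md : measurable_fun [set: R] (fun x : R => (c * x : measurableTypeR R)).
  exact: measurable_funM.
pose phi := fun x : R => (c * x : measurableTypeR R).
pose nu_ : {measure set (measurableTypeR R) -> \bar R} :=
  mscale (NngNum (ltW c0)) (pushforward mu phi).
pose nu := nu_ md.
have nuE A : measurable A -> mu A = nu A.
  apply: lebesgue_measure_unique => _ [[a b] _ <-].
  rewrite /nu/nu_/= /mscale/= /pushforward/=.
  rewrite [X in (_ * mu X)%E](_ : _ = `]a / c, b / c]%classic); last first.
    by apply/seteqP; split => x /=;
      rewrite /phi !in_itv/= ltr_pdivrMr// ler_pdivlMr// [(c * _)%R]mulrC.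
  rewrite !lebesgue_measure_itv/= !lte_fin ltr_pM2r ?invr_gt0//.
  case: ifPn => _; last by rewrite mule0.
  by rewrite -!EFinD -EFinM; congr EFin; field; rewrite gt_eqF.
rewrite (eq_measure_integral nu) => [|A mA _]; last exact: nuE.
rewrite /nu/nu_ ge0_integral_mscale//.
by rewrite ge0_integral_pushforward.
Qed.

(** The extended-real Gamma integral: unlike [Gamma], which is 0 when the
    integral diverges, it can be manipulated before its finiteness is known. *)
Definition gamma_integral s : \bar R :=
  (\int[mu]_(t in `]0%R, +oo[) (t `^ (s - 1) * expR (- t))%:E)%E.

Lemma GammaE s : Gamma s = fine (gamma_integral s).
Proof. by []. Qed.

Lemma measurable_gamma_integrand s c :
  measurable_fun [set: R] (fun t => t `^ (s - 1) * expR (- (c * t))).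
Proof.
apply: measurable_funM; first exact: measurable_powR.
by apply: measurableT_comp => //; apply: measurableT_comp => //;
  exact: measurable_funM.
Qed.

Lemma gamma_integral_dilation s c : 0 < c ->
  (\int[mu]_(t in `]0%R, +oo[) (t `^ (s - 1) * expR (- (c * t)))%:E =
   (c `^ (- s))%:E * gamma_integral s)%E.
Proof.
move=> c0; rewrite /gamma_integral [in RHS]integral_mkcond.
set F := (X in (_ * integral _ _ X)%E).
have F0 x : (0 <= F x)%E.
  rewrite /F patchE; case: ifP => // _.
  by rewrite lee_fin mulr_ge0 ?powR_ge0 ?expR_ge0.
have mF : measurable_fun setT F.
  apply/(measurable_restrictT _ _).1 => //; apply: measurable_funTS.
  apply/measurable_EFinP.
  have := measurable_gamma_integrand s 1.
  by under eq_fun do rewrite mul1r.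
rewrite (ge0_integral_dilation c0 mF F0).
have mFc : measurable_fun [set: R] (fun x => F (c * x)%R).
  by apply: measurableT_comp mF _; exact: measurable_funM.
rewrite muleA -EFinM -ge0_integralZl//; last first.
  by rewrite lee_fin mulr_ge0 ?powR_ge0 ?ltW.
rewrite [in LHS]integral_mkcond; apply: eq_integral => t _.
rewrite /F !patchE !mem_setE/= !in_itv/= !andbT pmulr_rgt0//.
case: ifPn => [t0|_]; last by rewrite mule0.
have c1 : c `^ (- s) * c * c `^ (s - 1) = 1.
  rewrite -[X in _ * X * _](powRr1 (ltW c0)) -!powRD ?(gt_eqF c0) ?implybT//.
  by rewrite (_ : - s + 1 + (s - 1) = 0) ?powRr0//; ring.
rewrite -[RHS]EFinM; congr EFin; rewrite powRM ?ltW// !mulrA; congr (_ * _).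
by rewrite c1 mul1r.
Qed.

Lemma integral_gauss_scaled a : 0 < a ->
  (\int[mu]_x (expR (- (a * x ^+ 2)))%:E = (Num.sqrt (pi / a))%:E)%E.
Proof.
move=> a0; have ra : 0 < Num.sqrt a by rewrite sqrtr_gt0.
have mg : measurable_fun [set: R] (fun x => (gauss_fun x)%:E).
  by apply/measurable_EFinP; exact: measurable_gauss_fun.
have := @integralT_gauss R.
rewrite (ge0_integral_dilation ra mg) => [|x]; last first.
  by rewrite lee_fin gauss_fun_ge0.
under eq_integral do rewrite /gauss_fun exprMn sqr_sqrtr ?(ltW a0)//.
move=> h; rewrite sqrtrM ?pi_ge0// sqrtrV ?(ltW a0)// mulrC EFinM -h.
by rewrite muleA -EFinM mulVf ?gt_eqF// mul1e.
Qed.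

Lemma measurable_gamma_mixture s nu :
  measurable_fun [set: R * R] (fun p : R * R =>
    (\1_(`]0%R, +oo[%classic) p.1 * (p.1 `^ (s - 1) *
      expR (- ((1 + p.2 ^+ 2 / nu) * p.1))))%:E).
Proof.
apply/measurable_EFinP; apply: measurable_funM.
  by apply: measurableT_comp => //; exact: measurable_indic.
apply: measurable_funM.
  by apply: (measurableT_comp (measurable_powR (s - 1))).
apply: measurableT_comp => //; apply: measurableT_comp => //.
apply: measurable_funM => //; apply: measurable_funD => //.
by apply: measurable_funM => //; apply: measurable_funX.
Qed.

Definition student_integral nu s : \bar R :=
  (\int[mu]_x ((1 + x ^+ 2 / nu) `^ (- s))%:E)%E.

Lemma measurable_student_kernel nu s :
  measurable_fun [set: R] (fun x => (1 + x ^+ 2 / nu) `^ (- s)).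
Proof.
apply: (measurableT_comp (measurable_powR (- s))).
by apply: measurable_funD => //; apply: measurable_funM.
Qed.

Lemma gamma_integral_ge0 s : (0 <= gamma_integral s)%E.
Proof.
by apply: integral_ge0 => t _; rewrite lee_fin mulr_ge0 ?powR_ge0 ?expR_ge0.
Qed.

(** Both sides are the integral over [t > 0] and all [x] of
    [t `^ (s - 1/2) * expR (- ((1 + x ^+ 2 / nu) * t))]. Integrating over [t]
    first is a dilation of the Gamma integral; integrating over [x] first is a
    Gaussian integral of variance [nu / (2 * t)]. *)
Lemma gamma_student_integral nu s : 0 < nu ->
  (gamma_integral (s + 2^-1) * student_integral nu (s + 2^-1) =
   (Num.sqrt (pi * nu))%:E * gamma_integral s)%E.
Proof.
move=> nu0.
pose h (p : R * R) := (\1_(`]0%R, +oo[%classic) p.1 *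
  (p.1 `^ (s + 2^-1 - 1) * expR (- ((1 + p.2 ^+ 2 / nu) * p.1))))%:E.
have h0 p : (0 <= h p)%E.
  by rewrite lee_fin mulr_ge0 ?mulr_ge0 ?powR_ge0 ?expR_ge0.
have := @fubini_tonelli _ _ _ _ _ mu mu h (measurable_gamma_mixture _ _) h0.
have -> : (\int[mu]_t \int[mu]_x h (t, x) =
           (Num.sqrt (pi * nu))%:E * gamma_integral s)%E.
  rewrite /gamma_integral [in RHS]integral_mkcond -ge0_integralZl//; last 2 first.
  - apply/(measurable_restrictT _ _).1 => //; apply: measurable_funTS.
    apply/measurable_EFinP; have := measurable_gamma_integrand s 1.
    by under eq_fun do rewrite mul1r.
  - move=> t _; rewrite patchE; case: ifP => // _.
    by rewrite lee_fin mulr_ge0 ?powR_ge0 ?expR_ge0.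
  apply: eq_integral => t _; rewrite patchE /h/= indicE.
  case: ifPn => [|_]; last first.
    by under eq_integral do rewrite mul0r; rewrite integral0 mule0.
  rewrite inE/= in_itv/= andbT => t0.
  have tn0 : 0 < t / nu by rewrite divr_gt0.
  transitivity (\int[mu]_x ((t `^ (s + 2^-1 - 1) * expR (- t))%:E *
                              (expR (- (t / nu * x ^+ 2)))%:E))%E.
    apply: eq_integral => x _; rewrite -EFinM; congr EFin.
    rewrite mul1r -[RHS]mulrA -expRD; congr (_ * expR _); ring.
  have mexp : measurable_fun [set: R] (fun x => (expR (- (t / nu * x ^+ 2)))%:E).
    apply/measurable_EFinP; apply: measurableT_comp => //.
    by apply: measurableT_comp => //; apply: measurable_funM.
  rewrite ge0_integralZl//; last by rewrite lee_fin mulr_ge0 ?powR_ge0 ?expR_ge0.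
  rewrite integral_gauss_scaled// -!EFinM; congr EFin.
  rewrite mulrAC [RHS]mulrA; congr (_ * _).
  have -> : pi / (t / nu) = pi * nu * t^-1 by field; rewrite !gt_eqF.
  rewrite sqrtrM ?mulr_ge0 ?pi_ge0 ?(ltW nu0)// sqrtrV ?(ltW t0)//.
  rewrite -(powR12_sqrt (ltW t0)) -powRN mulrCA; congr (_ * _).
  rewrite -powRD ?(gt_eqF t0) ?implybT//; congr (_ `^ _).
  by field.
move=> ->.
transitivity (\int[mu]_x (gamma_integral (s + 2^-1) *
    ((1 + x ^+ 2 / nu) `^ (- (s + 2^-1)))%:E))%E.
  rewrite ge0_integralZl//.
  - by apply/measurable_EFinP; exact: measurable_student_kernel.
  - by move=> x _; rewrite lee_fin powR_ge0.
  - exact: gamma_integral_ge0.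
apply: eq_integral => x _.
have c0 : 0 < 1 + x ^+ 2 / nu.
  by rewrite ltr_pwDl// divr_ge0 ?sqr_ge0 ?ltW.
rewrite muleC -gamma_integral_dilation// integral_mkcond.
apply: eq_integral => t _; rewrite patchE /h/= indicE.
by case: ifPn => _; rewrite ?mul1r ?mul0r.
Qed.

End student_normalisation.

Section student_constant.
Variable R : realType.
Local Notation mu := (@lebesgue_measure R).
Implicit Types s t x nu : R.

Lemma student_kernel_nonincreasing nu s t x : 0 < nu -> 0 <= s ->
  0 <= t <= x ->
  (1 + x ^+ 2 / nu) `^ (- s) <= (1 + t ^+ 2 / nu) `^ (- s).
Proof.
move=> nu0 s0 /andP[t0 tx].
have pos y : 0 < 1 + y ^+ 2 / nu.
  by rewrite ltr_pwDl// divr_ge0 ?sqr_ge0 ?ltW.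
rewrite !powRN lef_pV2 ?posrE ?powR_gt0//.
apply: ge0_ler_powR => //; rewrite ?nnegrE ?(ltW (pos _))//.
rewrite lerD2l ler_pM2r ?invr_gt0// lerXn2r// nnegrE//.
exact: le_trans tx.
Qed.

(** The kernel decreases away from 0, so on an interval of length 1 it is at
    least its value at the right end. *)
Lemma integral_student_kernel_ge nu s x (D : set R) : 0 < nu -> 0 <= s ->
  0 <= x -> measurable D -> `]x, x + 1]%classic `<=` D ->
  (((1 + (x + 1) ^+ 2 / nu) `^ (- s))%:E <=
   \int[mu]_(t in D) ((1 + t ^+ 2 / nu) `^ (- s))%:E)%E.
Proof.
move=> nu0 s0 x0 mD xD.
have mK A : measurable_fun A (fun t => ((1 + t ^+ 2 / nu) `^ (- s))%:E).
  by apply/measurable_EFinP/measurable_funTS; exact: measurable_student_kernel.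
apply: (@le_trans _ _
  (\int[mu]_(t in `]x, (x + 1)%R]) ((1 + t ^+ 2 / nu) `^ (- s))%:E)%E).
  apply: (@le_trans _ _
    (\int[mu]_(t in `]x, (x + 1)%R]) ((1 + (x + 1) ^+ 2 / nu) `^ (- s))%:E)%E).
    rewrite integral_cst//= lebesgue_measure_itv/= lte_fin ltrDl ltr01.
    by rewrite -EFinD -EFinM addrAC subrr add0r mulr1.
  apply: ge0_le_integral => //.
  - by move=> t _; rewrite lee_fin powR_ge0.
  - exact: mK.
  - move=> t /=; rewrite in_itv/= => /andP[xt tx]; rewrite lee_fin.
    apply: student_kernel_nonincreasing => //; rewrite tx andbT.
    exact: le_trans x0 (ltW xt).
apply: ge0_subset_integral => //; first exact: mK.
by move=> t _; rewrite lee_fin powR_ge0.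
Qed.

Lemma student_integral_gt0 nu s : 0 < nu -> 0 <= s ->
  (0 < student_integral nu s)%E.
Proof.
move=> nu0 s0.
have := @integral_student_kernel_ge nu s 0 setT nu0 s0 (lexx _) measurableT.
move=> /(_ (@subsetT _ _)); apply: lt_le_trans.
by rewrite lte_fin powR_gt0// ltr_pwDl// divr_ge0 ?sqr_ge0 ?ltW.
Qed.

Lemma integral_oneDsqr : (\int[mu]_x ((oneDsqr x)^-1)%:E = pi%:E)%E.
Proof.
rewrite ge0_symfun_integralT//.
- rewrite -set_itvcy integral0y_oneDsqr -EFinM; congr EFin.
  by field.
- exact: continuous_oneDsqrV.
- by move=> x /=; rewrite /oneDsqr sqrrN.
Qed.

Lemma gamma_integral1 : gamma_integral (1 : R) = 1%E.
Proof.
rewrite -(integral_exponential_pdf (ltr01 : 0 < 1 :> R)) /gamma_integral.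
rewrite integral_itv_obnd_cbnd; last first.
  apply/measurable_EFinP/measurable_funTS.
  have := measurable_gamma_integrand (1 : R) 1.
  by under eq_fun do rewrite mul1r.
rewrite integral_mkcond; apply: eq_integral => t _.
rewrite /exponential_pdf !patchE; case: ifPn => // _.
by rewrite subrr powRr0 mulN1r.
Qed.

Lemma mule_eq_pos_fin (a b : \bar R) (r : R) :
  (0 <= a)%E -> (0 < b)%E -> 0 < r -> (a * b = r%:E)%E ->
  [/\ (0 < a)%E, (a < +oo)%E & (b < +oo)%E].
Proof.
move=> a0 b0 r0.
have [->|an0] := eqVneq a 0%E; first by rewrite mul0e => -[] /eqP; rewrite lt_eqF.
have {a0 an0} a0 : (0 < a)%E by rewrite lt_neqAle eq_sym an0.
move: a b a0 b0 => [a| |] [b| |] // a0 b0.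
- by rewrite !ltry.
- by rewrite gt0_muley.
- by rewrite gt0_mulye.
Qed.

(** The identity [gamma_student_integral] for [nu = 1] and [s = 1/2] reads
    [Gamma(1) * pi = sqrt pi * Gamma(1/2)]. *)
Lemma gamma_integral_half : (0 < gamma_integral (2^-1 : R) < +oo)%E.
Proof.
have := @gamma_student_integral R 1 2^-1 ltr01.
rewrite -(_ : 1 = 2^-1 + 2^-1 :> R); last by lra.
rewrite gamma_integral1 mul1e /student_integral.
have -> : (\int[mu]_x ((1 + x ^+ 2 / 1) `^ (- 1))%:E = pi%:E)%E.
  rewrite -integral_oneDsqr; apply: eq_integral => x _.
  by rewrite divr1 powR_inv1// addr_ge0 ?sqr_ge0.
rewrite mulr1 muleC => /esym; case/mule_eq_pos_fin => //.
- exact: gamma_integral_ge0.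
- by rewrite lte_fin sqrtr_gt0 pi_gt0.
- exact: pi_gt0.
- by move=> -> ->.
Qed.

Lemma half_succn n : n.+1%:R / 2 = n%:R / 2 + 2^-1 :> R.
Proof. by rewrite -natr1 mulrDl div1r. Qed.

(** The identity propagates from [n] to [n + 1]: a product of nonnegative
    factors, one of them positive, that is positive and finite has positive
    finite factors. This gives the finiteness of the Student integral along
    with that of the Gamma values. *)
Lemma gamma_student_integral_fin n : (0 < n)%N ->
  [/\ (0 < gamma_integral (n%:R / 2 : R) < +oo)%E,
      (0 < gamma_integral (n.+1%:R / 2 : R) < +oo)%E &
      (student_integral n%:R (n.+1%:R / 2 : R) < +oo)%E].
Proof.
have step m (G : (0 < gamma_integral (m.+1%:R / 2 : R) < +oo)%E) :
    (0 < gamma_integral (m.+2%:R / 2 : R) < +oo)%E /\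
    (student_integral m.+1%:R (m.+2%:R / 2 : R) < +oo)%E.
  have := @gamma_student_integral R m.+1%:R (m.+1%:R / 2) (ltr0Sn _ _).
  rewrite -half_succn; case/andP: G => G0 Gy.
  rewrite -(fineK (_ : gamma_integral (m.+1%:R / 2) \is a fin_num)); last first.
    by rewrite ge0_fin_numE// ltW.
  rewrite -EFinM; case/mule_eq_pos_fin.
  - exact: gamma_integral_ge0.
  - by apply: student_integral_gt0; rewrite ?divr_ge0.
  - by rewrite mulr_gt0 ?sqrtr_gt0 ?mulr_gt0 ?pi_gt0// fine_gt0// G0.
  - by move=> -> -> ->.
case: n => // n _.
have G m : (0 < gamma_integral (m.+1%:R / 2 : R) < +oo)%E.
  elim: m => [|m /step[]//]; rewrite div1r; exact: gamma_integral_half.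
by have [? ?] := step n (G n).
Qed.

End student_constant.

(** * The tail of the Student distribution *)

Section student_ccdf_bounds.
Variable R : realType.
Local Notation mu := (@lebesgue_measure R).
Implicit Types x t : R.

Lemma student_cstE n : (0 < n)%N ->
  0 < fine (student_integral n%:R (n.+1%:R / 2 : R)) /\
  student_cst R n = (fine (student_integral n%:R (n.+1%:R / 2)))^-1.
Proof.
move=> n0; have nR0 : 0 < n%:R :> R by rewrite ltr0n.
have [/andP[g0 gy] /andP[h0 hy] Jy] := @gamma_student_integral_fin R n n0.
have J0 : (0 < student_integral n%:R (n.+1%:R / 2 : R))%E.
  by apply: student_integral_gt0; rewrite ?divr_ge0.
have := @gamma_student_integral R n%:R (n%:R / 2) nR0.
rewrite -half_succn -[gamma_integral (n.+1%:R / 2)]fineK ?ge0_fin_numE ?ltW//.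
rewrite -[gamma_integral (n%:R / 2)]fineK ?ge0_fin_numE ?ltW//.
rewrite -[student_integral _ _]fineK ?ge0_fin_numE ?ltW// -!EFinM => -[E].
have fJ0 : 0 < fine (student_integral n%:R (n.+1%:R / 2 : R)).
  by rewrite fine_gt0// J0.
split => //; rewrite /student_cst !GammaE -E invfM mulrA divff ?mul1r//.
by rewrite gt_eqF// fine_gt0// h0.
Qed.

Lemma student_cst_gt0 n : (0 < n)%N -> 0 < student_cst R n.
Proof. by move=> n0; have [J0 ->] := student_cstE n0; rewrite invr_gt0. Qed.

Lemma student_pdf_ge0 n x : (0 < n)%N -> 0 <= student_pdf n x.
Proof.
by move=> n0; rewrite mulr_ge0 ?powR_ge0// ltW ?student_cst_gt0.
Qed.

Lemma measurable_student_pdf n (A : set R) :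
  measurable_fun A (fun x => (student_pdf n x)%:E).
Proof.
apply/measurable_EFinP/measurable_funTS; apply: measurable_funM => //.
exact: measurable_student_kernel.
Qed.

Lemma integral_student_pdf n (A : set R) : (0 < n)%N -> measurable A ->
  (\int[mu]_(t in A) (student_pdf n t)%:E = (student_cst R n)%:E *
   \int[mu]_(t in A) ((1 + t ^+ 2 / n%:R) `^ (- (n.+1%:R / 2)))%:E)%E.
Proof.
move=> n0 mA; rewrite -ge0_integralZl//.
- apply/measurable_EFinP/measurable_funTS; exact: measurable_student_kernel.
- by move=> t _; rewrite lee_fin powR_ge0.
- by rewrite lee_fin ltW// student_cst_gt0.
Qed.

Lemma integralT_student_pdf n : (0 < n)%N ->
  (\int[mu]_t (student_pdf n t)%:E = 1)%E.
Proof.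
move=> n0; rewrite integral_student_pdf//.
rewrite -[X in (_ * X)%E]/(student_integral n%:R (n.+1%:R / 2)).
have [/andP[g0 gy] /andP[h0 hy] Jy] := @gamma_student_integral_fin R n n0.
have [J0 ->] := student_cstE n0.
rewrite -[X in (_ * X)%E]fineK ?ge0_fin_numE//; last first.
  by apply: integral_ge0 => t _; rewrite lee_fin powR_ge0.
by rewrite -EFinM mulVf ?gt_eqF.
Qed.

Lemma student_ccdfE n x : (0 < n)%N ->
  ((student_ccdf n x)%:E = \int[mu]_(t in `]x, +oo[) (student_pdf n t)%:E)%E.
Proof.
move=> n0; have := integralT_student_pdf n0.
have pdf0 t : (0 <= (student_pdf n t)%:E)%E.
  by rewrite lee_fin student_pdf_ge0.
rewrite -(setUv `]-oo, x]%classic) ge0_integral_setU//=; last 3 first.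
- exact: measurableC.
- exact: measurable_student_pdf.
- exact/disj_setPCl.
rewrite setCitvl.
pose a := (\int[mu]_(t in `]-oo, x]) (student_pdf n t)%:E)%E.
pose b := (\int[mu]_(t in `]x, +oo[) (student_pdf n t)%:E)%E.
rewrite -[X in (X = 1)%E -> _]/(a + b)%E -[X in _ -> (_ = X)%E]/b.
rewrite -[student_ccdf n x]/(1 - fine a).
have a0 : (0 <= a)%E by apply: integral_ge0 => t _; exact: pdf0.
have b0 : (0 <= b)%E by apply: integral_ge0 => t _; exact: pdf0.
move: a b a0 b0 => [a| |] [b| |] //= _ _ [E].
by congr EFin; lra.
Qed.

Lemma student_ccdf_gt0 n x : (0 < n)%N -> 0 <= x -> 0 < student_ccdf n x.
Proof.
move=> n0 x0; rewrite -lte_fin student_ccdfE// integral_student_pdf//.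
have nR0 : 0 < n%:R :> R by rewrite ltr0n.
rewrite mule_gt0 ?lte_fin ?student_cst_gt0//.
have s0 : 0 <= n.+1%:R / 2 :> R by rewrite divr_ge0.
have mI : measurable (`]x, +oo[%classic : set R) by [].
have := integral_student_kernel_ge nR0 s0 x0 mI.
have sub : `]x, x + 1]%classic `<=` (`]x, +oo[%classic : set R).
  by move=> t /=; rewrite !in_itv/= andbT => /andP[].
move=> /(_ sub); apply: lt_le_trans.
by rewrite lte_fin powR_gt0// ltr_pwDl// divr_ge0 ?sqr_ge0.
Qed.

(** The constant is the inverse of the integral of the kernel, which is at
    least the value of the kernel at 1, namely
    [(1 + 1 / n) `^ (- ((n + 1) / 2))], and this is at least [exp (- 1)]. *)
Lemma student_cst_le n : (0 < n)%N -> student_cst R n <= expR 1.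
Proof.
move=> n0; have nR0 : 0 < n%:R :> R by rewrite ltr0n.
have [J0 ->] := student_cstE n0.
have [_ _ Jy] := @gamma_student_integral_fin R n n0.
rewrite invf_ple ?posrE ?expR_gt0// -lee_fin fineK ?ge0_fin_numE//; last first.
  by apply: integral_ge0 => t _; rewrite lee_fin powR_ge0.
have := @integral_student_kernel_ge R n%:R (n.+1%:R / 2) 0 setT nR0.
move=> /(_ _ (lexx _) measurableT (@subsetT _ _)); rewrite divr_ge0//.
move=> /(_ isT); apply: le_trans; rewrite lee_fin add0r expr1n div1r.
rewrite powRN lef_pV2 ?posrE ?expR_gt0 ?powR_gt0//.
apply: (@le_trans _ _ (expR (n%:R^-1) `^ (n.+1%:R / 2))).
  apply: ge0_ler_powR; rewrite ?nnegrE ?expR_ge0 ?divr_ge0 ?addr_ge0 ?invr_ge0//.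
  exact: expR_ge1Dx.
rewrite -expRM ler_expR ler_pdivrMl// mulr1 ler_pdivrMr//.
rewrite -natrM ler_nat; lia.
Qed.

Lemma bernoulli_inequality m (y : R) : 0 <= y -> 1 + m%:R * y <= (1 + y) ^+ m.
Proof.
move=> y0; elim: m => [|m IH]; first by rewrite mul0r addr0 expr0.
rewrite exprS -natr1; apply: (@le_trans _ _ ((1 + y) * (1 + m%:R * y))).
  have : 0 <= m%:R * y ^+ 2 by rewrite mulr_ge0 ?sqr_ge0.
  by nra.
by rewrite ler_wpM2l// addr_ge0.
Qed.

(** A domination uniform in [n]. Rounding the exponent [(n + 1) / 2] down to an
    integer, which is still at least [n / 2], leaves a natural power, and the
    Bernoulli inequality bounds it below by [1 + t ^+ 2 / 2]. *)
Lemma student_kernel_le n t : (0 < n)%N ->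
  (1 + t ^+ 2 / n%:R) `^ (- (n.+1%:R / 2)) <= 2 * (oneDsqr t)^-1.
Proof.
move=> n0; have nR0 : 0 < n%:R :> R by rewrite ltr0n.
have y0 : 0 <= t ^+ 2 / n%:R by rewrite divr_ge0 ?sqr_ge0.
have le1 : 1 + t ^+ 2 / 2 <= (1 + t ^+ 2 / n%:R) `^ (n.+1%:R / 2).
  apply: (@le_trans _ _ ((1 + t ^+ 2 / n%:R) `^ (n.+1)./2%:R)); last first.
    apply: ler_powR; first by rewrite lerDl.
    rewrite ler_pdivlMr// -natrM ler_nat; lia.
  rewrite powR_mulrn ?addr_ge0//; apply: le_trans (bernoulli_inequality _ y0).
  rewrite lerD2l mulrCA ler_wpM2l ?sqr_ge0// ler_pdivlMr// mulrC.
  rewrite ler_pdivrMr// -natrM ler_nat; lia.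
have p0 : 0 < 1 + t ^+ 2 / 2 by rewrite ltr_pwDl// divr_ge0 ?sqr_ge0.
rewrite powRN (le_trans (_ : _ <= (1 + t ^+ 2 / 2)^-1))//.
  by rewrite lef_pV2 ?posrE// (lt_le_trans p0).
have q0 : 0 < oneDsqr t by rewrite /oneDsqr ltr_pwDl// sqr_ge0.
rewrite ler_pdivlMr// mulrC ler_pdivrMr// /oneDsqr.
have := sqr_ge0 t; lra.
Qed.

Lemma integral_tail_oneDsqr x :
  (\int[mu]_(t in `[x, +oo[) ((oneDsqr t)^-1)%:E = (pi / 2 - atan x)%:E)%E.
Proof.
rewrite (ge0_continuous_FTC2y _ _ (@cvgy_atan R))//=.
- apply: continuous_subspaceT; exact: continuous_oneDsqrV.
- by apply: cvg_at_right_filter; exact: continuous_atan.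
- by move=> t _; rewrite derive1E; exact: derive_val.
Qed.

Lemma student_ccdf_le n x : (0 < n)%N ->
  student_ccdf n x <= expR 1 * (2 * (pi / 2 - atan x)).
Proof.
move=> n0; rewrite -lee_fin student_ccdfE// integral_student_pdf//.
rewrite [leRHS]EFinM; apply: lee_pmul.
- by rewrite lee_fin ltW// student_cst_gt0.
- by apply: integral_ge0 => t _; rewrite lee_fin powR_ge0.
- by rewrite lee_fin student_cst_le.
have mO : measurable_fun [set: R] (fun t : R => ((oneDsqr t)^-1)%:E).
  apply/measurable_EFinP; apply: continuous_measurable_fun.
  exact: continuous_oneDsqrV.
rewrite [leRHS]EFinM -integral_tail_oneDsqr -ge0_integralZl//; last first.
  exact: measurable_funTS mO.
apply: (@le_trans _ _
    (\int[mu]_(t in `]x, +oo[) (2%:E * ((oneDsqr t)^-1)%:E))%E).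
  apply: ge0_le_integral => //.
  - by move=> t _; rewrite lee_fin powR_ge0.
  - by apply/measurable_EFinP/measurable_funTS; exact: measurable_student_kernel.
  - by apply: measurable_funTS; exact: measurable_funeM.
  - by move=> t _; rewrite -EFinM lee_fin student_kernel_le.
apply: ge0_subset_integral => //.
- by apply: measurable_funTS; exact: measurable_funeM.
- by move=> t /=; rewrite !in_itv/= !andbT => /ltW.
Qed.

Lemma student_ccdf_cvg0 (x : nat -> R) : x n @[n --> \oo] --> +oo ->
  student_ccdf n (x n) @[n --> \oo] --> 0.
Proof.
move=> xy.
have ub : expR 1 * (2 * (pi / 2 - atan (x n))) @[n --> \oo] --> (0 : R).
  rewrite [X in _ --> X](_ : _ = expR 1 * (2 * (pi / 2 - pi / 2))); last first.
    by rewrite subrr !mulr0.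
  apply: cvgM; first exact: cvg_cst.
  apply: cvgM; first exact: cvg_cst.
  apply: cvgB; first exact: cvg_cst.
  exact: cvg_comp xy (@cvgy_atan R).
apply: squeeze_cvgr (cvg_cst 0) ub.
near=> n; have n0 : (0 < n)%N by near: n; exact: nbhs_infty_gt.
rewrite student_ccdf_le// andbT ltW// student_ccdf_gt0//.
by near: n; move/cvgryPge : xy; exact.
Unshelve. all: by end_near. Qed.

End student_ccdf_bounds.

(** * Relative errors *)

Lemma limn_einf_ge (R : realType) (u : (\bar R)^nat) (a : \bar R) :
  (\forall n \near \oo, (a <= u n)%E) -> (a <= limn_einf u)%E.
Proof.
move=> [N _ uN]; rewrite limn_einf_lim; apply: lime_ge.
  exact: is_cvg_einfs.
exists N => // n /= Nn; apply: le_ereal_inf_tmp => _ [m /= nm <-].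
by apply: uN; exact: leq_trans nm.
Qed.

Theorem theorem2 (R : realType) :
  ((1 / 4)%:E <= limn_einf (fun n : nat =>
     ereal_inf [set sup_rel_error n x | x in [set x : R | (0 <= x)%R]]))%E
  /\
  forall x : nat -> R,
    (forall n, (1 <= n)%N -> 0 < x n) ->
    (forall m n, (1 <= m)%N -> (m <= n)%N -> x m <= x n) ->
    x n @[n --> \oo] --> +oo ->
    x n / Num.sqrt n%:R @[n --> \oo] --> (0 : R) ->
    sup_rel_error n (x n) @[n --> \oo] --> (+oo%E : \bar R).
Proof.
split.
  apply: limn_einf_ge; near=> n.
  have n0 : (0 < n)%N by near: n; exact: nbhs_infty_gt.
  apply: le_ereal_inf_tmp => _ [x /= x0 <-].
  by apply: le_trans (sup_rel_error_ge_half n0 x0); rewrite lee_fin; lra.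
move=> x xgt0 _ xy xsqrt; apply/cvgeyPge => M.
(* With [theta = 1/2] the error is at least [1 / (2 * ccdf) - 1], which exceeds
   [M] once [ccdf < 1 / (2 * B)]. *)
pose B : R := `|M| + 1.
have B0 : 0 < B by rewrite ltr_pwDr.
have ccdf_small : \forall n \near \oo, student_ccdf n (x n) < (2 * B)^-1.
  apply: (cvgr_lt _ (student_ccdf_cvg0 xy)).
  by rewrite invr_gt0 mulr_gt0.
near=> n.
have n0 : (0 < n)%N by near: n; exact: nbhs_infty_gt.
have r0 : 0 < Num.sqrt n%:R :> R by rewrite sqrtr_gt0 ltr0n.
have xn : x n <= Num.sqrt n%:R.
  have : x n / Num.sqrt n%:R < 1 by near: n; exact: (cvgr_lt _ xsqrt).
  by rewrite ltr_pdivrMr// mul1r => /ltW.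
have D0 : 0 < student_ccdf n (x n) by rewrite student_ccdf_gt0// ltW ?xgt0.
have t01 : 0 < (2^-1 : R) < 1 by apply/andP; split; lra.
apply: le_trans (sup_rel_error_ge n0 t01 xn _); last by rewrite gt_eqF.
rewrite lee_fin gtr0_norm//.
have : 2 * B < (student_ccdf n (x n))^-1.
  by rewrite -[2 * B]invrK ltf_pV2 ?posrE ?invr_gt0 ?mulr_gt0//; near: n.
have := ler_norm M; rewrite /B; lra.
Unshelve. all: by end_near. Qed.
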